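(* Fix integers $b,t\ge 1$ and a real $\delta>0$. Then for all sufficiently large $n$ (depending on $b,t,\delta$), \[ \tau_t(K_n^b)\le (1+\delta)tn, \] where $K_n^b$ is the Cartesian product of $b$ copies of the complete graph $K_n$.
   Context: $K_n^b$ has vertex set $[n]^b$, with two vertices adjacent iff they differ in exactly one coordinate (so the distance between two vertices is their Hamming distance). For an integer $t\ge1$, a $t$-tone coloring of a graph $G$ assigns to each vertex $v$ a set $f(v)$ of exactly $t$ colors from a color set $C$ such that $|f(u)\cap f(v)|<d(u,v)$ for all distinct vertices $u,v$, where $d(u,v)$ is the graph distance. $\tau_t(G)$ is the minimum $|C|$ over all $t$-tone colorings of $G$. *)

(* Defs.v *)
From HB Require Import structures.
From mathcomp Require Import all_boot all_order all_algebra.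
From mathcomp Require Import reals.

Set Implicit Arguments.
Unset Strict Implicit.
Unset Printing Implicit Defensive.

Record sgraph := SGraph {
  vertex :> finType;
  adj : rel vertex;
  adj_sym : symmetric adj;
  adj_irr : irreflexive adj }.
Arguments adj {s}.

Section Distance.
Variable G : sgraph.
Implicit Types (u v : G) (k : nat).

Definition has_walk u v k : bool :=
  [exists p : k.-tuple G, path adj u p && (last u p == v)].

(* The least length of a walk from u to v. A shortest walk has fewer than #|G| *)
(* edges; if u and v lie in different components the value #|G| is junk.       *)
Definition gdist u v : nat := find (has_walk u v) (iota 0 #|G|).

Lemma gdist_gt0 u v : u != v -> 0 < gdist u v.
Proof.
move=> nuv; rewrite /gdist; have: 0 < #|G| by apply/card_gt0P; exists u.
case: #|G| => // m _ /=; case: ifP => // /existsP[p /andP[_]].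
by rewrite (tuple0 p) /= (negPf nuv).
Qed.

Lemma gdistP u v m : has_walk u v m ->
  (forall k, has_walk u v k -> m <= k) -> gdist u v = m.
Proof.
move=> wm minm; have ltm : m < #|G|.
  have /existsP[p /andP[pp /eqP lp]] := wm.
  case/shortenP: pp lp => q qq uq _ lq.
  have wq : has_walk u v (size q).
    by apply/existsP; exists (in_tuple q); rewrite /= qq lq eqxx.
  by apply: leq_ltn_trans (minm _ wq) _; have := max_card [in u :: q]; rewrite (card_uniqP uq).
rewrite /gdist; apply/eqP; rewrite eqn_leq; apply/andP; split.
  rewrite leqNgt; apply/negP => /(before_find 0).
  by rewrite nth_iota // add0n wm.
have hs : has (has_walk u v) (iota 0 #|G|).
  by apply/hasP; exists m => //; rewrite mem_iota.
have lt := hs; rewrite has_find size_iota in lt.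
by apply: minm; have := nth_find 0 hs; rewrite nth_iota.
Qed.

End Distance.

Section Tone.
Variables (t : nat) (G : sgraph).

(* Vertices in different components are at infinite distance, so they impose *)
(* no condition.                                                             *)
Definition tone_coloring (k : nat) (f : {ffun G -> {set 'I_k}}) : bool :=
  [forall v, #|f v| == t] &&
  [forall u, forall v, (u != v) && connect adj u v ==>
     (#|f u :&: f v| < gdist u v)].

Definition tone_colorable (k : nat) : bool :=
  [exists f : {ffun G -> {set 'I_k}}, tone_coloring f].

Lemma tone_colorable_ex : exists k, tone_colorable k.
Proof.
pose C : finType := (G * 'I_t)%type; exists #|C|.
pose f := [ffun v : G => [set i : 'I_#|C| | (enum_val i).1 == v]].
apply/existsP; exists f; apply/andP; split.
  apply/forallP => v; apply/eqP.
  have -> : f v = [set enum_rank ((v, j) : C) | j : 'I_t].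
    apply/setP => i; rewrite ffunE inE; apply/eqP/imsetP => [<-|[j _ ->]].
      by exists (enum_val i).2; rewrite // -surjective_pairing enum_valK.
    by rewrite enum_rankK.
  by rewrite card_imset ?card_ord // => i j /enum_rank_inj [].
apply/forallP => u; apply/forallP => v; apply/implyP => /andP[nuv _].
suff -> : f u :&: f v = set0 by rewrite cards0 gdist_gt0.
apply/setP => i; rewrite !ffunE !inE.
by apply/negbTE/negP => /andP[/eqP -> /eqP E]; rewrite E eqxx in nuv.
Qed.

Definition tone_chromatic_number : nat := ex_minn tone_colorable_ex.

End Tone.

Notation "\tau_ t G" := (tone_chromatic_number t G)
  (at level 10, t at level 2, G at level 9, format "\tau_ t  G").

Section Complete.
Variable n : nat.
Definition complete_adj : rel 'I_n := fun i j => i != j.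
Lemma complete_sym : symmetric complete_adj.
Proof. by move=> i j; rewrite /complete_adj /= eq_sym. Qed.
Lemma complete_irr : irreflexive complete_adj.
Proof. by move=> i; rewrite /complete_adj /= eqxx. Qed.
Definition complete_graph : sgraph := SGraph complete_sym complete_irr.
End Complete.

Section CartesianPower.
Variables (G : sgraph) (b : nat).
Definition cart_adj : rel {ffun 'I_b -> G} :=
  fun u v => [exists i, adj (u i) (v i) && [forall (j | j != i), u j == v j]].
Lemma cart_sym : symmetric cart_adj.
Proof.
move=> u v; apply: eq_existsb => i; rewrite adj_sym; congr (_ && _).
by apply: eq_forallb => j /=; congr (_ ==> _); exact: eq_sym.
Qed.
Lemma cart_irr : irreflexive cart_adj.
Proof. by move=> u; apply/existsP => -[i]; rewrite adj_irr. Qed.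
Definition cart_power : sgraph := SGraph cart_sym cart_irr.
End CartesianPower.

Definition Kpow (n b : nat) : sgraph := cart_power (complete_graph n) b.

Section KpowFacts.
Variables n b : nat.
Implicit Types u v w : {ffun 'I_b -> 'I_n}.

Definition hamming u v : nat := #|[set i | u i != v i]|.

Lemma Kpow_adjE (u v : Kpow n b) : adj u v = (hamming u v == 1).
Proof.
apply/existsP/cards1P => -[i].
  case/andP=> ni /forallP H; exists i; apply/setP => j; rewrite !inE.
  by have := H j; case: eqVneq => [->|_ /eqP ->]; rewrite ?eqxx.
move=> E; exists i; apply/andP; split; first by have := set11 i; rewrite -E inE.
apply/forallP => j; apply/implyP => nji; apply/negPn.
by have := in_set1 j i; rewrite -E inE (negPf nji) => ->.
Qed.

Lemma hamming_triangle u v w : hamming u w <= hamming u v + hamming v w.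
Proof.
rewrite (leq_trans _ (leq_card_setU _ _)) // subset_leq_card //.
apply/subsetP => i; rewrite !inE; apply: contraR.
by rewrite negb_or !negbK => /andP[/eqP -> /eqP ->].
Qed.

Lemma Kpow_gdistE (u v : Kpow n b) : gdist u v = hamming u v.
Proof.
apply: gdistP; last first.
  move=> k /existsP[p /andP[pp /eqP <-]]; rewrite -[X in _ <= X](size_tuple p).
  elim: (tval p) u pp => [|x s IH] u.
    by move=> _; rewrite /hamming leqn0 cards_eq0; apply/eqP/setP => i; rewrite !inE eqxx.
  case/andP; rewrite Kpow_adjE => /eqP ux /IH le.
  by apply: leq_trans (hamming_triangle u x _) _; rewrite ux ltnS.
move E: (hamming u v) => m; elim: m u E => [|m IH] u E.
  apply/existsP; exists [tuple]; apply/eqP/ffunP => i /=.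
  move/eqP: E; rewrite cards_eq0 => /eqP /setP /(_ i).
  by rewrite !inE => /negbFE /eqP.
have /card_gt0P[i] : 0 < hamming u v by rewrite E.
rewrite inE => ni.
pose x : {ffun 'I_b -> 'I_n} := [ffun j => if j == i then v i else u j].
have ux : adj (u : Kpow n b) x.
  rewrite Kpow_adjE; apply/cards1P; exists i; apply/setP => j; rewrite !inE ffunE.
  by case: (eqVneq j i) => [->|]; rewrite ?eqxx ?ni.
have /IH/existsP[p /andP[pp lp]] : hamming x v = m.
  apply/eqP; rewrite -eqSS -E /hamming [X in _ == X](cardsD1 i) inE ni add1n eqSS; apply/eqP.
  apply: eq_card => j; rewrite !inE ffunE.
  by case: (eqVneq j i) => [->|]; rewrite ?eqxx.
by apply/existsP; exists [tuple of (x : Kpow n b) :: p]; apply/andP; split=> //; apply/andP.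
Qed.

End KpowFacts.

(* Main.v *)
Require Import Defs.
From mathcomp Require Import all_boot all_order all_algebra.
From mathcomp Require Import reals.
Local Open Scope ring_scope.

(** Reed-Solomon colouring. Pick [m], with [n <= m <= n + O(1)], all of whose
    prime factors exceed [b + t], and read a vertex as the vector of values at
    [0, ..., b-1] of a polynomial of degree less than [b] over Z/m. Its [t]
    colours are the pairs (i, value of the polynomial at [b + i]), [i < t]. If two
    vertices at distance [d] shared [d] colours, the difference of their
    polynomials would have [b] roots with invertible differences, hence vanish.
    The prime factor condition is met by some [m = 1] modulo [(b + t)!], so no
    information on gaps between primes is needed. *)

Import Order.TTheory GRing.Theory Num.Theory.

Set Implicit Arguments.
Unset Strict Implicit.
Unset Printing Implicit Defensive.

Section Interpolation.
Variables (R : comUnitRingType) (N : nat).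
Hypothesis unitN : forall k, (0 < k < N)%N -> (k%:R : R) \is a GRing.unit.

Lemma natr_sub_unit i j : (i < N)%N -> (j < N)%N -> i != j ->
  (i%:R - j%:R : R) \is a GRing.unit.
Proof.
wlog ltji : i j / (j < i)%N => [hw iN jN nij|iN _ _].
  case: (ltngtP i j) (nij) => // lt _; last exact: hw.
  by rewrite -opprB unitrN; apply: hw; rewrite // eq_sym.
rewrite -natrB 1?ltnW //; apply: unitN.
by rewrite subn_gt0 ltji (leq_ltn_trans (leq_subr _ _)).
Qed.

Lemma uniq_roots_natr (s : seq nat) : uniq s -> {in s, forall k, k < N}%N ->
  uniq_roots [seq (k%:R : R) | k <- s].
Proof.
elim: s => //= x s IHs /andP[xs us] ltN; apply/andP; split; last first.
  by apply: IHs => // k ks; apply: ltN; rewrite inE ks orbT.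
apply/allP => _ /mapP[k ks ->]; rewrite /diff_roots mulrC eqxx /=.
apply: natr_sub_unit; rewrite ?ltN ?inE ?eqxx ?ks ?orbT //.
by apply: contraNneq xs => <-.
Qed.

(** In a ring with zero divisors, distinct roots may outnumber the degree; the usual bound survives
    because the differences of these roots are units, which is what [uniq_roots] records. *)
Lemma poly_eq0_natr_roots (p : {poly R}) (s : seq nat) :
  uniq s -> {in s, forall k, k < N}%N -> {in s, forall k, root p k%:R} ->
  (size p <= size s)%N -> p = 0.
Proof.
move=> us ltN rp; apply: contraTeq => p0; rewrite -ltnNge.
rewrite -(size_map (fun k => k%:R : R)); apply: max_ring_poly_roots => //.
  by apply/allP => _ /mapP[k ks ->]; exact: rp.
exact: uniq_roots_natr.
Qed.

Variable b : nat.

(* Lagrange interpolation without denominators: the value at [j] is [x j] up to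
   a unit depending only on [j]. *)
Definition interp (x : 'I_b -> R) : {poly R} :=
  \sum_j x j *: \prod_(k < b | k != j) ('X - (k%:R)%:P).

Lemma size_interp x : (size (interp x) <= b)%N.
Proof.
apply: leq_trans (size_sum _ _ _) _; apply/bigmax_leqP => j _.
apply: leq_trans (size_scale_leq _ _) _.
rewrite (eq_bigl (mem (predC1 j))) // -big_enum size_prod_XsubC -cardE cardC1.
by rewrite card_ord prednK // (leq_ltn_trans _ (ltn_ord j)).
Qed.

Lemma interpB x y : interp (fun j => x j - y j) = interp x - interp y.
Proof. by rewrite -sumrB; apply: eq_bigr => j _; rewrite scalerBl. Qed.

Lemma interpE x (j : 'I_b) :
  (interp x).[j%:R] = x j * \prod_(k < b | k != j) (j%:R - k%:R).
Proof.
(* Every summand other than the [j]-th contains the factor ['X - j] and vanishes at [j]. *)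
rewrite horner_sum (bigD1 j) //= [X in _ + X]big1 ?addr0 => [|i nij].
  rewrite hornerZ horner_prod; congr (_ * _).
  by apply: eq_bigr => k _; rewrite hornerXsubC.
rewrite hornerZ horner_prod (bigD1 j) 1?eq_sym //=.
by rewrite hornerXsubC subrr mul0r mulr0.
Qed.

Lemma interp_eq0 x : (b <= N)%N -> interp x = 0 -> forall j, x j = 0.
Proof.
move=> bN x0 j; have := interpE x j; rewrite x0 horner0 => /esym/eqP.
rewrite mulIr_eq0 => [/eqP //|]; apply/mulIr/unitr_prod => k nkj.
by apply: natr_sub_unit; rewrite 1?eq_sym // (leq_trans (ltn_ord _)).
Qed.

End Interpolation.

Section ToneColoring.
Variables (R : finComUnitRingType) (n b t : nat) (g : 'I_n -> R).
Hypothesis g_inj : injective g.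
Hypothesis unitN : forall k, (0 < k < b + t)%N -> (k%:R : R) \is a GRing.unit.

Let vpoly (v : {ffun 'I_b -> 'I_n}) : {poly R} := interp (fun j => g (v j)).
Let color v (i : 'I_t) : 'I_t * R := (i, (vpoly v).[(b + i)%:R]).

Lemma card_common_values (u v : {ffun 'I_b -> 'I_n}) : u != v ->
  (#|[set i | color u i == color v i]| < hamming u v)%N.
Proof.
set A := [set i | _]; apply: contraNltn => leA.
(* The list [s] collects roots of the difference: agreeing coordinates, all below [b], and points
   [b + i] with equal colours. With Hamming distance d there are [b] - d of the first kind and, by
   [leA], at least d of the second. *)
pose E := [set j | u j == v j].
pose s := [seq val j | j <- enum E] ++ [seq (b + val i)%N | i <- enum A].
have: vpoly u - vpoly v = 0.
  apply: (poly_eq0_natr_roots unitN (s := s)).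
  - rewrite cat_uniq !map_inj_uniq ?enum_uniq //=; last 2 first.
    + by move=> i j /addnI/val_inj.
    + exact: val_inj.
    rewrite andbT; apply/hasPn => _ /mapP[i _ ->].
    apply/negP => /mapP[j _] /eqP; rewrite eqn_leq => /andP[+ _].
    by rewrite leqNgt (leq_trans (ltn_ord j)) ?leq_addr.
  - move=> k; rewrite mem_cat => /orP[] /mapP[i _ ->].
      by rewrite (leq_trans (ltn_ord i)) ?leq_addr.
    by rewrite ltn_add2l; exact: ltn_ord.
  - move=> k; rewrite mem_cat => /orP[] /mapP[i]; rewrite mem_enum inE => /eqP e ->.
      by rewrite /root hornerD hornerN !interpE e subrr.
    by case: e => e; rewrite /root hornerD hornerN e subrr.
  rewrite -interpB; apply: leq_trans (size_interp _) _.
  rewrite size_cat !size_map -!cardE; apply: leq_trans (leq_add (leqnn _) leA).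
  have -> : hamming u v = #|~: E| by apply: eq_card => j; rewrite !inE.
  by rewrite cardsC card_ord.
rewrite -interpB => /(interp_eq0 unitN (leq_addr _ _)) uv.
by apply/eqP/ffunP => j; apply/g_inj/eqP; rewrite -subr_eq0 uv.
Qed.

Lemma tone_colorable_Kpow : tone_colorable t (Kpow n b) (t * #|R|).
Proof.
rewrite -[t in (t * _)%N]card_ord -card_prod.
apply/existsP; exists [ffun v : Kpow n b => [set enum_rank (color v i) | i : 'I_t]].
have cinj v : injective (fun i => enum_rank (color v i)).
  by move=> i j /enum_rank_inj[].
apply/andP; split.
  by apply/forallP => v; rewrite ffunE card_imset ?card_ord.
apply/forallP => u; apply/forallP => v; apply/implyP => /andP[nuv _].
rewrite !ffunE Kpow_gdistE; apply: leq_ltn_trans (card_common_values nuv).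
(* The index stored in a colour forces a common colour to arise from the same [i] at both
   vertices. *)
rewrite -(card_imset _ (cinj u)); apply/subset_leq_card/subsetP => c.
rewrite inE => /andP[/imsetP[i _ ->] /imsetP[j _ e]].
apply: imset_f; rewrite inE.
by case: (enum_rank_inj e) => ij _; apply/eqP/enum_rank_inj; rewrite e ij.
Qed.

End ToneColoring.

Lemma tone_chromatic_Kpow_le n b t :
  (\tau_t (Kpow n b) <= t * (n + (b + t)`! + 1))%N.
Proof.
(* One more than the least multiple of [M] above [n], so [n < m <= n + M + 1]. *)
set M := (b + t)`!; pose m := ((n %/ M).+1 * M).+1.
have M0 : (0 < M)%N by exact: fact_gt0.
have nm : (n < m)%N by rewrite ltnS ltnW // ltn_ceil.
have m1 : (1 < m)%N by rewrite ltnS muln_gt0.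
have col : tone_colorable t (Kpow n b) (t * m).
  have <- : #|'Z_m| = m by rewrite card_ord Zp_cast.
  apply: (@tone_colorable_Kpow _ _ _ _ (fun i : 'I_n => (i%:R : 'Z_m))).
    move=> i j /(congr1 val) /=; rewrite !val_Zp_nat //.
    by rewrite !modn_small ?(ltn_trans (ltn_ord _) nm) // => /val_inj.
  (* Such a [k] divides [M], hence [m - 1], and is therefore coprime to [m]. *)
  move=> k /andP[k0 kN]; rewrite unitZpE // coprime_sym.
  have kM : (k %| M)%N by apply: dvdn_fact; rewrite k0 ltnW.
  by rewrite (coprime_dvdl (dvdn_mull (n %/ M).+1 kM)) // coprimenS.
rewrite /tone_chromatic_number; case: ex_minnP => c _ /(_ _ col).
move/leq_trans; apply; rewrite leq_mul2l addn1 ltnS mulSn addnC.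
by rewrite leq_add2r leq_trunc_div orbT.
Qed.

Theorem theorem1p15 (R : realType) (b t : nat) (delta : R) :
  (1 <= b)%N -> (1 <= t)%N -> 0 < delta ->
  exists N : nat, forall n : nat, (N <= n)%N ->
    (\tau_t (Kpow n b))%:R <= (1 + delta) * t%:R * n%:R.
Proof.
move=> _ _ d0; pose c : R := ((b + t)`! + 1)%:R.
(* Beyond [c / delta] the additive constant [c] is absorbed by [delta * n]. *)
exists (Num.truncn (c / delta)).+1 => n ltn.
have cn : c <= delta * n%:R.
  rewrite mulrC -ler_pdivrMr // ltW // (lt_le_trans (truncnS_gt _)) //.
  by rewrite ler_nat.
have := tone_chromatic_Kpow_le n b t; rewrite -(ler_nat R) => /le_trans; apply.
rewrite -addnA natrM natrD -/c mulrAC [leRHS]mulrC ler_wpM2l //.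
by rewrite mulrDl mul1r lerD2l.
Qed.
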